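(* Let $G,H$ be graphs, and let $A,B$ be subgraphs of $G$ such that $G=A\cup B$. Then: (1) $\max\{\mathrm{C}(A;H),\mathrm{C}(B;H)\}\leq \mathrm{C}(G;H)\leq \mathrm{C}(A;H)+\mathrm{C}(B;H)$. (2) $\max\{\mathrm{IC}(A;H),\mathrm{IC}(B;H)\}\leq \mathrm{IC}(G;H)\leq \mathrm{IC}(A;H)+\mathrm{IC}(B;H)$.
   Context: ''Graph'' means either an undirected graph (loops allowed) or a directed graph (a set of vertices with a binary relation), without multiple edges; all graphs in the statement are of the same kind. The vertex and edge (arc) sets of $G$ are $V(G)$, $E(G)$. A homomorphism $f:G\to H$ is a map $f:V(G)\to V(H)$ with $f(u)f(v)\in E(H)$ whenever $uv\in E(G)$; it is injective if it is injective on vertices and the induced map on edges is injective (the former implies the latter). A subgraph of $G$ is a graph whose vertex and edge sets are subsets of $V(G)$, $E(G)$. The union $G_1\cup\cdots\cup G_k$ has vertex set $\bigcup_i V(G_i)$ and edge set $\bigcup_i E(G_i)$. The hom-complexity $\mathrm{C}(G;H)$ is the least positive integer $k$ such that there are subgraphs $G_1,\dots,G_k$ of $G$ with $G=G_1\cup\cdots\cup G_k$ and, for each $i$, a homomorphism $G_i\to H$; $\mathrm{C}(G;H)=\infty$ if no such $k$ exists. The injective hom-complexity $\mathrm{IC}(G;H)$ is defined in the same way, requiring for each $i$ an injective homomorphism $G_i\to H$. Sums with a term $\infty$ equal $\infty$. *)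

(* Defs.v *)
From mathcomp Require Import all_boot all_order all_algebra.
From mathcomp Require Import boolp classical_sets constructive_ereal.
Set Implicit Arguments.
Unset Strict Implicit.
Unset Printing Implicit Defensive.
Local Open Scope classical_set_scope.

Inductive graph_kind := Undirected | Directed.

(* An undirected edge uv is the set {u, v}, a singleton when it is a loop. *)
Definition edge (k : graph_kind) (T : Type) : Type :=
  match k with Undirected => set T | Directed => (T * T)%type end.

Definition mkedge (k : graph_kind) (T : Type) (u v : T) : edge k T :=
  match k return edge k T with
  | Undirected => [set u; v]
  | Directed => (u, v)
  end.
Arguments mkedge k {T} u v.

(* The vertices form a possibly empty or infinite set inside an ambient type
   T; subgraphs and unions live in the same ambient type. *)
Record graph (k : graph_kind) (T : Type) := Graph {
  vset : set T;
  eset : set (edge k T);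
  eset_wf : forall e, eset e ->
    exists u v, [/\ vset u, vset v & e = mkedge k u v] }.

Definition subgraph (k : graph_kind) (T : Type) (A G : graph k T) : Prop :=
  vset A `<=` vset G /\ eset A `<=` eset G.

Section Unions.
Variables (k : graph_kind) (T : Type).

Lemma gunion_wf (A B : graph k T) (e : edge k T) :
  (eset A `|` eset B) e ->
  exists u v, [/\ (vset A `|` vset B) u, (vset A `|` vset B) v
                & e = mkedge k u v].
Proof.
by case=> /eset_wf[u [v [uV vV ->]]]; exists u, v; split=> //;
  solve [by left | by right].
Qed.

Definition gunion (A B : graph k T) : graph k T := Graph (@gunion_wf A B).

Lemma gbigunion_wf (I : Type) (F : I -> graph k T) (e : edge k T) :
  (\bigcup_i eset (F i)) e ->
  exists u v, [/\ (\bigcup_i vset (F i)) u, (\bigcup_i vset (F i)) v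
                & e = mkedge k u v].
Proof.
by case=> i _ /eset_wf[u [v [uV vV ->]]]; exists u, v; split=> //; exists i.
Qed.

Definition gbigunion (I : Type) (F : I -> graph k T) : graph k T :=
  Graph (@gbigunion_wf I F).

End Unions.

Section Homomorphisms.
Variables (k : graph_kind) (T T' : Type) (G : graph k T) (H : graph k T').

(* Maps are between the vertex sets themselves, not the ambient types, so that
   an empty graph maps to every H even when T' is empty. *)
Definition is_hom (f : vset G -> vset H) : Prop :=
  forall u v : vset G, eset G (mkedge k (val u) (val v)) ->
    eset H (mkedge k (val (f u)) (val (f v))).

Definition edge_injective (f : vset G -> vset H) : Prop :=
  forall u v u' v' : vset G,
    eset G (mkedge k (val u) (val v)) ->
    eset G (mkedge k (val u') (val v')) ->
    mkedge k (val (f u)) (val (f v)) = mkedge k (val (f u')) (val (f v')) ->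
    mkedge k (val u) (val v) = mkedge k (val u') (val v').

Definition has_hom : Prop := exists f : vset G -> vset H, is_hom f.

Definition has_inj_hom : Prop :=
  exists f : vset G -> vset H, [/\ is_hom f, injective f & edge_injective f].

End Homomorphisms.

Definition decomposable (k : graph_kind) (T : Type) (P : graph k T -> Prop)
    (G : graph k T) (n : nat) : Prop :=
  (0 < n)%N /\ exists F : 'I_n -> graph k T,
    [/\ forall i, subgraph (F i) G, G = gbigunion F & forall i, P (F i)].

Definition least (P : nat -> Prop) : \bar int :=
  match pselect (exists n, `[< P n >]) with
  | left exP => (Posz (ex_minn exP))%:E
  | right _ => +oo%E
  end.

Definition hom_complexity (k : graph_kind) (T T' : Type)
    (G : graph k T) (H : graph k T') : \bar int :=
  least (decomposable (fun A => has_hom A H) G).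

Definition inj_hom_complexity (k : graph_kind) (T T' : Type)
    (G : graph k T) (H : graph k T') : \bar int :=
  least (decomposable (fun A => has_inj_hom A H) G).

(* Main.v *)
(* A decomposition of G restricts to any subgraph by intersecting each piece
   with it, and decompositions of A and B concatenate to one of A ∪ B. Only the
   fact that the pieces range over a class closed under subgraphs matters, and
   both "has a homomorphism to H" and "has an injective homomorphism to H" are
   such classes. *)
Require Import Defs.
From mathcomp Require Import all_boot all_order all_algebra.
From mathcomp Require Import boolp classical_sets constructive_ereal.
Set Implicit Arguments.
Unset Strict Implicit.
Unset Printing Implicit Defensive.
Local Open Scope classical_set_scope.

Section Least.

Variant least_spec (P : nat -> Prop) : \bar int -> Type :=
  | LeastFin n of P n & (forall m, P m -> (n <= m)%N) :
      least_spec P (Posz n)%:E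
  | LeastInfty of (forall n, ~ P n) : least_spec P +oo%E.

Lemma leastP (P : nat -> Prop) : least_spec P (least P).
Proof.
rewrite /least; case: pselect => [exP|nexP].
  case: ex_minnP => n /asboolP Pn minn; constructor=> // m Pm.
  exact/minn/asboolP.
by constructor=> n Pn; apply: nexP; exists n; apply/asboolP.
Qed.

Lemma least_le (P : nat -> Prop) (n : nat) :
  P n -> (least P <= (Posz n)%:E)%E.
Proof.
move=> Pn; case: leastP => [m _ /(_ n Pn) lemn|/(_ n)//].
by rewrite lee_fin lez_nat.
Qed.

(** Enlarging a set of naturals can only lower its minimum; an empty [Q] has the value [+oo], above
    everything. *)
Lemma le_least (P Q : nat -> Prop) :
  (forall n, Q n -> P n) -> (least P <= least Q)%E.
Proof.
move=> QP; case: (leastP Q) => [n Qn _|_]; last exact: leey.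
exact/least_le/QP.
Qed.

Lemma least_le_add (P Q R : nat -> Prop) :
  (forall m n, P m -> Q n -> R (m + n)%N) ->
  (least R <= least P + least Q)%E.
Proof.
(* An infinite summand makes the right side [+oo]; otherwise the sum of the two minima itself
   satisfies [R]. *)
move=> PQR; case: (leastP P) => [m Pm _|_]; case: (leastP Q) => [n Qn _|_];
  rewrite ?addye ?addey ?leey // -EFinD -PoszD.
exact/least_le/PQR.
Qed.

End Least.

Section Graphs.
Variables (k : graph_kind) (T : Type).
Implicit Types (A B G : graph k T).

Lemma graph_eq A B : vset A = vset B -> eset A = eset B -> A = B.
Proof.
case: A B => [V E wf] [V' E' wf'] /= VV' EE'.
by subst V' E'; rewrite (Prop_irrelevance wf wf').
Qed.

(** Well-formedness only provides some endpoints of an edge; this transfers membership to any given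
    pair representing it. *)
Lemma eset_vset G (u v : T) : eset G (mkedge k u v) -> vset G u /\ vset G v.
Proof.
case: k G => G /= uvG; have [x [y [xG yG]]] := eset_wf uvG; last by case=> -> ->.
(* An equality of unordered pairs does not match [u], [v] with [x], [y] in order, so each element of
   the set is shown to be a vertex. *)
move=> /= uvxy; have sub w : [set u; v] w -> vset G w.
  by rewrite uvxy => -[] ->.
by split; apply: sub; [left | right].
Qed.

(** The endpoints supplied by [A] also lie in [B], because the same edge belongs to [B]. *)
Lemma gcap_wf A B (e : edge k T) : (eset A `&` eset B) e ->
  exists u v, [/\ (vset A `&` vset B) u, (vset A `&` vset B) v
                & e = mkedge k u v].
Proof.
move=> [eA]; have [u [v [uA vA ->]]] := eset_wf eA.
by case/eset_vset=> uB vB; exists u, v.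
Qed.

Definition gcap A B : graph k T := Graph (@gcap_wf A B).

Lemma subgraph_trans B A G : subgraph A B -> subgraph B G -> subgraph A G.
Proof.
move=> [vAB eAB] [vBG eBG].
by split; [apply: subset_trans vBG | apply: subset_trans eBG].
Qed.

Lemma subgraph_capl A B : subgraph (gcap A B) A.
Proof. by split=> x []. Qed.

Lemma subgraph_capr A B : subgraph (gcap A B) B.
Proof. by split=> x []. Qed.

Lemma gcap_bigunion (I : Type) (F : I -> graph k T) A :
  subgraph A (gbigunion F) -> A = gbigunion (fun i => gcap (F i) A).
Proof.
move=> [vAF eAF]; apply: graph_eq; apply/seteqP; split=> x /=.
- by move=> xA; have [i _ xF] := vAF _ xA; exists i.
- by case=> i _ [].
- by move=> xA; have [i _ xF] := eAF _ xA; exists i.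
- by case=> i _ [].
Qed.

(** [split] and [unsplit] identify ['I_(m + n)] with the disjoint sum of ['I_m] and ['I_n]. *)
Lemma bigcup_split (U : Type) m n (F : 'I_m -> set U) (F' : 'I_n -> set U) :
  \bigcup_i (match split i with inl j => F j | inr j => F' j end) =
  \bigcup_i F i `|` \bigcup_i F' i.
Proof.
apply/seteqP; split=> x /=.
  by case=> i _; case: (split i) => j xF; [left | right]; exists j.
case=> -[j _ xF].
  by exists (unsplit (inl j)) => //; rewrite unsplitK.
by exists (unsplit (inr j)) => //; rewrite unsplitK.
Qed.

Section Decomposable.
Variable P : graph k T -> Prop.

Lemma decomposable_sub A G (n : nat) :
    (forall B C, subgraph B C -> P C -> P B) -> subgraph A G ->
  decomposable P G n -> decomposable P A n.
Proof.
move=> Psub AG [n_gt0 [F [_ GF PF]]]; split=> //.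
exists (fun i => gcap (F i) A); split=> [i||i].
- exact: subgraph_capr.
- by apply: gcap_bigunion; rewrite -GF.
- exact: Psub (subgraph_capl _ _) (PF i).
Qed.

Lemma decomposable_union A B (m n : nat) :
  decomposable P A m -> decomposable P B n ->
  decomposable P (gunion A B) (m + n).
Proof.
move=> [m_gt0 [F [FA AF PF]]] [_ [F' [FB BF PF']]].
split; first by rewrite addn_gt0 m_gt0.
exists (fun i => match split i with inl j => F j | inr j => F' j end).
split=> [i||i]; last by case: split.
- case: split => j.
    by apply: subgraph_trans (FA j) _; split; apply: subsetUl.
  by apply: subgraph_trans (FB j) _; split; apply: subsetUr.
(* The two remaining goals only commute [vset] and [eset] with the case distinction on [split i]. *)
- rewrite AF BF; apply: graph_eq => /=; rewrite -bigcup_split.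
    by apply: eq_bigcupr => i _; case: split.
  by apply: eq_bigcupr => i _; case: split.
Qed.

Lemma least_decomposable_bounds A B :
    (forall C D, subgraph C D -> P D -> P C) ->
  (Order.max (least (decomposable P A)) (least (decomposable P B))
     <= least (decomposable P (gunion A B)))%E /\
  (least (decomposable P (gunion A B))
     <= least (decomposable P A) + least (decomposable P B))%E.
Proof.
move=> Psub; split; last first.
  by apply: least_le_add => m n; apply: decomposable_union.
rewrite Order.TotalTheory.ge_max; apply/andP; split; apply: le_least => n;
  apply: decomposable_sub => //.
  by split; apply: subsetUl.
by split; apply: subsetUr.
Qed.

End Decomposable.

Section Restriction.
Variables (T' : Type) (H : graph k T').

(** The inclusion of vertex sets keeps the underlying value, so restricting a homomorphism is
    precomposition with it. *)
Definition vincl A G (AG : subgraph A G) (x : vset A) : vset G :=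
  exist _ (val x) (mem_set (AG.1 _ (set_mem (valP x)))).

Lemma has_hom_sub A G : subgraph A G -> has_hom G H -> has_hom A H.
Proof.
move=> AG [f fhom]; exists (f \o vincl AG) => u v /AG.2 uvG.
exact: (fhom (vincl AG u) (vincl AG v)).
Qed.

Lemma has_inj_hom_sub A G : subgraph A G -> has_inj_hom G H -> has_inj_hom A H.
Proof.
move=> AG [f [fhom finj feinj]]; exists (f \o vincl AG); split.
- by move=> u v /AG.2 uvG; apply: (fhom (vincl AG u) (vincl AG v)).
- by move=> x y /finj /(congr1 (@proj1_sig _ _)) /= xy; apply: val_inj.
- move=> u v u' v' /AG.2 uvG /AG.2 uvG'.
  exact: (feinj (vincl AG u) (vincl AG v) (vincl AG u') (vincl AG v')).
Qed.

End Restriction.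

End Graphs.

Theorem theorem3p17 (k : graph_kind) (T T' : Type)
    (G A B : graph k T) (H : graph k T')
    (subA : subgraph A G) (subB : subgraph B G) (GAB : G = gunion A B) :
  ((Order.max (hom_complexity A H) (hom_complexity B H)
      <= hom_complexity G H)%E /\
   (hom_complexity G H <= hom_complexity A H + hom_complexity B H)%E) /\
  ((Order.max (inj_hom_complexity A H) (inj_hom_complexity B H)
      <= inj_hom_complexity G H)%E /\
   (inj_hom_complexity G H
      <= inj_hom_complexity A H + inj_hom_complexity B H)%E).
Proof.
(* Both complexities unfold to [least (decomposable P _)], which leaves closure of each [P] under
   subgraphs. *)
rewrite GAB; split; apply: least_decomposable_bounds => C D.
  exact: has_hom_sub.
exact: has_inj_hom_sub.
Qed.
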